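(* Let $t\ge 3$ and $1\le n_1\le\cdots\le n_t$, and let $K_{n_1,\dots,n_t}$ be the complete $t$-partite graph with class sizes $n_1,\dots,n_t$. Let $m=\sum_{i=1}^{t-1}n_i$ and $n=n_t$. Then (a) $rc^\ell(K_{n_1,\dots,n_t})=1$ if $n_t=1$; $=2$ if $n_t\ge 2$ and $m>n$; and $=\min(\lceil\sqrt[m]{n}\,\rceil,3)$ if $m\le n$; (b) $src^\ell(K_{n_1,\dots,n_t})=1$ if $n_t=1$; $=2$ if $n_t\ge 2$ and $m>n$; and $=\lceil\sqrt[m]{n}\,\rceil$ if $m\le n$.
   Context: An edge-coloured path is rainbow if all its edges have distinct colours; a geodesic is a shortest path between its endpoints. An (not necessarily proper) edge-colouring of a connected graph is rainbow connected (resp. strongly rainbow connected) if any two vertices are joined by a rainbow path (resp. rainbow geodesic). An $r$-edge-list assignment of $G$ assigns to each edge $e$ a set $L(e)\subset\mathbb N$ with $|L(e)|\ge r$; an $L$-edge-colouring is an edge-colouring $c$ with $c(e)\in L(e)$ for all $e$. $rc^\ell(G)$ (resp. $src^\ell(G)$) is the minimum integer $r$ such that for every $r$-edge-list assignment $L$ of $G$ there exists a rainbow connected (resp. strongly rainbow connected) $L$-edge-colouring of $G$. *)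

(* Defs.v *)
From mathcomp Require Export all_boot all_order all_algebra all_field.
From mathcomp Require Export classical_sets cardinality.

Set Implicit Arguments.
Unset Strict Implicit.
Unset Printing Implicit Defensive.

Import Num.Theory.

Record sgraph := SGraph {
  vertex :> finType;
  adj : rel vertex;
  adj_sym : symmetric adj;
  adj_irrefl : irreflexive adj
}.

Definition edges (G : sgraph) : {set {set G}} :=
  [set [set p.1; p.2] | p : G * G & adj p.1 p.2].

(* The path is x :: p; it has size p edges. *)
Definition is_path (G : sgraph) (x y : G) (p : seq G) : Prop :=
  [/\ path (@adj G) x p, last x p = y & uniq (x :: p)].

Definition is_geodesic (G : sgraph) (x y : G) (p : seq G) : Prop :=
  is_path x y p /\ forall q, is_path x y q -> size p <= size q.

(* An edge-colouring is a total function on sets of vertices; only its values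
   on edges matter. The same holds for list assignments below. *)
Definition rainbow (G : sgraph) (c : {set G} -> nat) (x : G) (p : seq G) : Prop :=
  uniq (pairmap (fun u v => c [set u; v]) x p).

Definition rainbow_connected (G : sgraph) (c : {set G} -> nat) : Prop :=
  forall x y : G, exists p, is_path x y p /\ rainbow c x p.

Definition strongly_rainbow_connected (G : sgraph) (c : {set G} -> nat) : Prop :=
  forall x y : G, exists p, is_geodesic x y p /\ rainbow c x p.

(* The lists may be infinite. *)
Definition list_assignment (G : sgraph) (r : nat) (L : {set G} -> set nat) : Prop :=
  forall e, e \in edges G -> (`I_r #<= L e)%card.

Definition list_colouring (G : sgraph) (L : {set G} -> set nat)
    (c : {set G} -> nat) : Prop :=
  forall e, e \in edges G -> L e (c e).

Definition is_minimum (P : nat -> Prop) (r : nat) : Prop :=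
  P r /\ forall s, P s -> r <= s.

(* is_rcl G r means rc^l(G) = r, including that the minimum exists;
   likewise is_srcl for src^l. *)
Definition is_rcl (G : sgraph) : nat -> Prop :=
  is_minimum (fun r => forall L, @list_assignment G r L ->
    exists c, list_colouring L c /\ rainbow_connected c).

Definition is_srcl (G : sgraph) : nat -> Prop :=
  is_minimum (fun r => forall L, @list_assignment G r L ->
    exists c, list_colouring L c /\ strongly_rainbow_connected c).

Definition multipartite_adj (t : nat) (n : 'I_t -> nat) :
    rel {i : 'I_t & 'I_(n i)} :=
  fun x y => tag x != tag y.

Lemma multipartite_adj_sym (t : nat) (n : 'I_t -> nat) :
  symmetric (@multipartite_adj t n).
Proof. by move=> x y; rewrite /multipartite_adj eq_sym. Qed.

Lemma multipartite_adj_irrefl (t : nat) (n : 'I_t -> nat) :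
  irreflexive (@multipartite_adj t n).
Proof. by move=> x; rewrite /multipartite_adj eqxx. Qed.

Definition complete_multipartite (t : nat) (n : 'I_t -> nat) : sgraph :=
  SGraph (@multipartite_adj_sym t n) (@multipartite_adj_irrefl t n).

(* For m > 0, m.-root of a nonnegative real in algC is its nonnegative real
   m-th root, so the ceiling is a nonnegative integer and absz only casts it. *)
Definition ceil_root (m n : nat) : nat :=
  `|Num.ceil (m.-root (n%:R : algC))%R|%N.

(* Main.v *)
(** Write [A] for the largest class, of size [n], and [B] for its complement, of
    size [m].  Two vertices of one class are joined by a rainbow geodesic as soon
    as the colour vectors of their edges to some other class differ, so for the
    upper bounds on [src^l] it suffices to colour the [A x B] matrix of edges so
    that all rows, and all columns of a common class, are distinct.  On a square
    submatrix of side [min m n] lists of size 2 suffice, adding one row and one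
    column at a time; the remaining rows or columns are chosen greedily, which
    works because [n <= r ^ m] when [m <= n], and because the classes have at most
    [n < 2 ^ n] vertices when [m > n].

    For [rc^l <= 3], fix [u] and [w] in two different classes of [B], and colour
    [xu] and [xw], for every [x] in [A], with distinct colours other than that of
    [uw]: any [x], [y] in [A] with equal colours on these edges are joined by the
    rainbow path [x u w y].  The other columns are again chosen greedily.

    For the lower bounds, give all edges the list [{0, ..., s - 1}]: a rainbow
    path has length at most [s], and if paths of length 2 suffice then the [n]
    rows are distinct vectors of [{0, ..., s - 1} ^ m]. *)

Require Import Defs.
From mathcomp Require Import boolp functions finset.

Set Implicit Arguments.
Unset Strict Implicit.
Unset Printing Implicit Defensive.

Import GRing.Theory Order.TTheory Num.Theory.

Lemma ceil_root_le (m n s : nat) : 0 < m -> (ceil_root m n <= s) = (n <= s ^ m).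
Proof.
move=> m_gt0; rewrite /ceil_root.
have root_ge0 : (0 <= m.-root (n%:R : algC))%R.
  by rewrite rootC_ge0 // ler0n.
have root_real : (m.-root (n%:R : algC) \is Num.real)%R by rewrite ger0_real.
have ceil_nneg : (0 <= Num.ceil (m.-root (n%:R : algC)))%R.
  by rewrite real_ceil_ge0 //; apply: lt_le_trans root_ge0; rewrite oppr_lt0 ltr01.
rewrite -lez_nat gez0_abs // real_ceil_le_int // -pmulrn.
rewrite -[X in (_ <= X)%R](exprCK m_gt0 (ler0n _ s)) -natrX.
by rewrite ler_rootC ?nnegrE ?ler0n // ler_nat.
Qed.

(** * Matrices with distinct rows and columns, chosen from lists *)

(* Each [x] in [S] rules out at most one of the [r ^ #|T|] vectors on [T]. *)
Lemma list_avoid (I Y : finType) (r : nat) (l : Y -> seq nat)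
    (S : {set I}) (T : {set Y}) (w : I -> Y -> nat) :
    0 < r -> (forall y, uniq (l y)) -> (forall y, r <= size (l y)) ->
    #|S| < r ^ #|T| ->
  exists2 h : Y -> nat, forall y, h y \in l y
    & forall x, x \in S -> exists2 y, y \in T & h y != w x y.
Proof.
case: r => // r _ l_uniq l_size ltST.
(* A vector [u] gives positions in the lists; off [T] the position defaults to 0. *)
pose idx (u : {ffun {y | y \in T} -> 'I_r.+1}) y : nat :=
  oapp (fun z => nat_of_ord (u z)) 0 (insub y).
have idx_lt u y : idx u y < size (l y).
  apply: leq_trans (l_size y); rewrite /idx.
  by case: insub => //= z; apply: ltn_ord.
pose h u y := nth 0 (l y) (idx u y).
have [[u uP]|noU] := pselect (exists u, forall x, x \in S ->
    exists2 y, y \in T & h u y != w x y).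
  by exists (h u) => // y; apply: mem_nth.
have bad u : exists2 x, x \in S & forall y, y \in T -> h u y = w x y.
  apply: contrapT => no_x; apply: noU; exists u => x xS.
  apply: contrapT => no_y; apply: no_x; exists x => // y yT.
  by apply: contrapT => /eqP neq; apply: no_y; exists y.
(* If every [u] is matched on [T] by some [x] in [S], then [x] determines [u], because the lists
   have no duplicates. *)
have /choice[b bP] : forall u, exists x,
    x \in S /\ forall y, y \in T -> h u y = w x y.
  by move=> u; have [x] := bad u; exists x.
have b_inj : injective b.
  move=> u v eq_b; apply/ffunP => z; apply/val_inj => /=.
  have [_ /(_ _ (valP z)) hu] := bP u; have [_ /(_ _ (valP z)) hv] := bP v.
  move: hu; rewrite eq_b -hv /h => /eqP; rewrite nth_uniq // /idx valK /=.
  by move/eqP.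
suff : #|{ffun {y | y \in T} -> 'I_r.+1}| <= #|S|.
  by rewrite card_ffun card_ord card_sig leqNgt ltST.
rewrite -[X in X <= _](card_imset predT b_inj).
apply/subset_leq_card/fintype.subsetP => _ /imsetP[u _ ->].
by have [] := bP u.
Qed.

(** The relation [e] selects the pairs to tell apart: all pairs in the largest class, but only pairs
    of a common class outside it. Columns are treated by transposing [f]. *)
Definition rows_separated (X Y : finType) (e : rel X) (f : X -> Y -> nat)
    (S : {set X}) (T : {set Y}) : Prop :=
  forall x x', x \in S -> x' \in S -> e x x' -> x != x' ->
    exists2 y, y \in T & f x y != f x' y.

(** Greedy choice: a new row has fewer than [r ^ #|T|] vectors to avoid on [T]. Rows in [S] are
    kept, so columns already told apart on [S] stay so. *)
Lemma extend_rows (X Y : finType) (r : nat) (L : X -> Y -> seq nat) (e : rel X)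
    (S : {set X}) (T : {set Y}) (f : X -> Y -> nat) :
    0 < r -> (forall x y, uniq (L x y)) -> (forall x y, r <= size (L x y)) ->
    symmetric e -> (forall x, #|[set x' | e x x'] :\ x| < r ^ #|T|) ->
    (forall x y, f x y \in L x y) -> rows_separated e f S T ->
  exists g : X -> Y -> nat,
    [/\ forall x y, g x y \in L x y, forall x, x \in S -> g x = f x
      & rows_separated e g setT T].
Proof.
move=> r_gt0 L_uniq L_size e_sym e_small.
have [k] := ubnP #|~: S|; elim: k S f => // k IH S f.
have [S0 _ f_adm f_sep|[x xS] cardS f_adm f_sep] := set_0Vmem (~: S).
  by exists f; split=> //; rewrite -setC0 -S0 setCK.
(* The row avoids the current values of all its [e]-neighbours, including those still to be
   replaced. *)
have [h h_adm h_avoid] := list_avoid f r_gt0 (L_uniq x) (L_size x) (e_small x).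
pose f' x' := if x' == x then h else f x'.
have [|x'||g [g_adm g_eq g_sep]] := IH (x |: S) f'.
- rewrite -ltnS; apply: leq_trans cardS; rewrite ltnS setCU setIC -setDE.
  by rewrite [X in _ < X](cardsD1 x) xS.
- by move=> y; rewrite /f'; case: eqP => [->|].
- move=> a b; rewrite !inE /f' => aS bS e_ab ab.
  have [ax|ax] := eqVneq a x.
    have [bx|bx] := eqVneq b x; first by rewrite ax bx eqxx in ab.
    by apply: h_avoid; rewrite !inE bx -ax.
  have [bx|bx] := eqVneq b x.
    have [|y yT hy] := h_avoid a; first by rewrite !inE ax -bx e_sym.
    by exists y => //; rewrite eq_sym.
  by apply: f_sep => //; [move: aS; rewrite (negPf ax)
                         | move: bS; rewrite (negPf bx)].
exists g; split=> // x' x'S; rewrite g_eq ?inE ?x'S ?orbT // /f'.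
by case: eqP x'S xS => // ->; rewrite inE => ->.
Qed.

(* A new row and a new column are chosen outside their intersection, where
   [2 ^ k > k] leaves room to avoid the [k] old ones. *)
Lemma square_separated (X Y : finType) (r : nat) (L : X -> Y -> seq nat)
    (S : {set X}) (T : {set Y}) :
    1 < r -> (forall x y, uniq (L x y)) -> (forall x y, r <= size (L x y)) ->
    #|S| = #|T| ->
  exists f : X -> Y -> nat,
    [/\ forall x y, f x y \in L x y, rows_separated [rel _ _ | true] f S T
      & rows_separated [rel _ _ | true] (fun y x => f x y) T S].
Proof.
move=> r_gt1 L_uniq L_size; have r_gt0 := ltnW r_gt1.
elim: {S}#|S| {-2}S (erefl #|S|) T => [|k IH] S cardS T; rewrite cardS => cardT.
  have /choice[f f_adm] : forall p : X * Y, exists c, c \in L p.1 p.2.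
    move=> [x y]; exists (nth 0 (L x y) 0); apply: mem_nth.
    exact: leq_trans r_gt0 (L_size x y).
  exists (fun x y => f (x, y)); split=> [x y|x x'|y y'].
  - exact: f_adm (x, y).
  - by rewrite (cards0_eq cardS) inE.
  - by rewrite (cards0_eq (esym cardT)) inE.
have [|[x xS]] := set_0Vmem S; first by move=> S0; rewrite S0 cards0 in cardS.
have [|[y yT]] := set_0Vmem T; first by move=> T0; rewrite T0 cards0 in cardT.
have cardS' : #|S :\ x| = k.
  by apply/eqP; rewrite -eqSS -cardS (cardsD1 x S) xS.
have cardT' : #|T :\ y| = k.
  by apply/eqP; rewrite -eqSS cardT (cardsD1 y T) yT.
have [|f [f_adm f_rows f_cols]] := IH _ cardS' (T :\ y).
  by rewrite cardS' cardT'.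
have k_lt : k < r ^ k by apply: ltn_expl.
have [|a a_adm a_avoid] := list_avoid (S := S :\ x) (T := T :\ y) f r_gt0
  (L_uniq x) (L_size x); first by rewrite cardS' cardT'.
have [|b b_adm b_avoid] := list_avoid (S := T :\ y) (T := S :\ x)
  (fun y' x' => f x' y') r_gt0 (L_uniq^~ y) (L_size^~ y).
  by rewrite cardS' cardT'.
(* The corner [(x, y)] receives [a y]; every separation below is found in [T :\ y] or [S :\ x]. *)
exists (fun x' y' => if x' == x then a y' else if y' == y then b x' else f x' y').
split=> [x' y'|x1 x2 x1S x2S _ x12|y1 y2 y1T y2T _ y12].
- by case: eqP => [->|_] //; case: eqP => [->|_].
- have [x1x|x1x] := eqVneq x1 x.
    have [x2x|x2x] := eqVneq x2 x; first by rewrite x1x x2x eqxx in x12.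
    have [|y'] := a_avoid x2; rewrite !inE ?x2x // => /andP[y'y y'T] neq.
    by exists y' => //; rewrite (negPf y'y).
  have [x2x|x2x] := eqVneq x2 x.
    have [|y'] := a_avoid x1; rewrite !inE ?x1x // => /andP[y'y y'T] neq.
    by exists y' => //; rewrite (negPf y'y) eq_sym.
  have [||//|//|y'] := f_rows x1 x2; rewrite !inE ?x1x ?x2x //.
  by move=> /andP[y'y y'T] neq; exists y' => //; rewrite (negPf y'y).
- have [y1y|y1y] := eqVneq y1 y.
    have [y2y|y2y] := eqVneq y2 y; first by rewrite y1y y2y eqxx in y12.
    have [|x'] := b_avoid y2; rewrite !inE ?y2y // => /andP[x'x x'S] neq.
    by exists x' => //; rewrite (negPf x'x).
  have [y2y|y2y] := eqVneq y2 y.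
    have [|x'] := b_avoid y1; rewrite !inE ?y1y // => /andP[x'x x'S] neq.
    by exists x' => //; rewrite (negPf x'x) eq_sym.
  have [||//|//|x'] := f_cols y1 y2; rewrite !inE ?y1y ?y2y //.
  by move=> /andP[x'x x'S] neq; exists x' => //; rewrite (negPf x'x).
Qed.

(** * Finite selections, and crossing edges as matrix entries *)

Lemma subset_of_card (T : finType) (A : {set T}) (k : nat) :
  k <= #|A| -> exists2 S : {set T}, S \subset A & #|S| = k.
Proof.
move=> kA; exists [set x in take k (enum A)].
  by apply/fintype.subsetP => x; rewrite inE => /mem_take; rewrite mem_enum.
rewrite cardsE (card_uniqP (take_uniq _ (enum_uniq _))) size_take -cardE.
by case: ltngtP kA.
Qed.

Lemma list_pick_avoid2 (s : seq nat) (a b : nat) :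
  uniq s -> 2 < size s -> exists2 c, c \in s & (c != a) && (c != b).
Proof.
move=> s_uniq s_size; apply/hasP; apply: contraLR s_size => /hasPn no_c.
rewrite -leqNgt; apply: (uniq_leq_size (s2 := [:: a; b])) => // c /no_c.
by rewrite !inE negb_and !negbK.
Qed.

(** Membership in [A] orients a crossing edge, so its row and column are well defined. *)
Lemma set2_crossing_inj (V : finType) (A : {set V}) (x y x' y' : V) :
    x \in A -> y \notin A -> x' \in A -> y' \notin A ->
  [set x; y] = [set x'; y'] -> x = x' /\ y = y'.
Proof.
move=> xA yA x'A y'A /setP eq2; split.
  have := eq2 x; rewrite !inE eqxx => /esym/orP[/eqP//|/eqP xy'].
  by rewrite -xy' xA in y'A.
have := eq2 y; rewrite !inE eqxx orbT => /esym/orP[/eqP yx'|/eqP//].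
by rewrite yx' x'A in yA.
Qed.

(** Sets that do not cross take the head of their list. This value is known in advance, which the
    rainbow paths through an edge outside [A] rely on. *)
Lemma colouring_of_matrix (V : finType) (A : {set V}) (l : {set V} -> seq nat)
    (f : V -> V -> nat) :
    (forall e, 0 < size (l e)) -> (forall x y, f x y \in l [set x; y]) ->
  exists c : {set V} -> nat,
    [/\ forall e, c e \in l e,
        forall x y, x \in A -> y \notin A -> c [set x; y] = f x y
      & forall x y, x \notin A -> y \notin A ->
          c [set x; y] = head 0 (l [set x; y])].
Proof.
move=> l_size f_adm.
pose crossing e := [pred p : V * V |
  [&& p.1 \in A, p.2 \notin A & e == [set p.1; p.2]]].
exists (fun e =>
  if [pick p | crossing e p] is Some p then f p.1 p.2 else head 0 (l e)).
split=> [e|x y xA yA|x y xA yA].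
- case: pickP => [[x y] /and3P[_ _ /eqP ->] //|_].
  by case: (l e) (l_size e) => //= a s _; rewrite inE eqxx.
- case: pickP => [[x' y'] /and3P[/= x'A y'A /eqP eq2]|/(_ (x, y))].
    by have [-> ->] := set2_crossing_inj xA yA x'A y'A eq2.
  by rewrite /= xA yA eqxx.
- case: pickP => [[x' y'] /and3P[/= x'A _ /eqP /setP/(_ x')]|//].
  rewrite !inE eqxx => /orP[]/eqP x'E; first by rewrite x'E (negPf xA) in x'A.
  by rewrite x'E (negPf yA) in x'A.
Qed.

(** Cuts possibly infinite lists down to sequences of exactly [r] colours, defined on every set of
    vertices, so that later choices need no edge hypothesis. *)
Lemma list_assignmentP (G : sgraph) (r : nat) (L : {set G} -> set nat) :
    list_assignment r L ->
  exists l : {set G} -> seq nat, [/\ forall e, uniq (l e),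
    forall e, size (l e) = r
  & forall e, e \in edges G -> forall k, k \in l e -> L e k].
Proof.
move=> LP; suff /choice[l lP] : forall e, exists s : seq nat,
    [/\ uniq s, size s = r & e \in edges G -> forall k, k \in s -> L e k].
  by exists l; split=> e; have [] := lP e.
move=> e; have [/LP/pcard_leP/unsquash f|_] := boolP (e \in edges G); last first.
  (* A set that is not an edge gets an arbitrary sequence. *)
  by exists (iota 0 r); rewrite iota_uniq size_iota.
exists [seq f i | i <- iota 0 r]; rewrite size_map size_iota; split=> //.
  rewrite map_inj_in_uniq ?iota_uniq // => i j; rewrite !mem_iota !add0n /= => ir jr.
  by apply: (@inj _ _ _ f); apply: mem_set.
move=> _ k /mapP[i]; rewrite mem_iota add0n /= => ir ->.
exact: (@funS _ _ _ _ f).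
Qed.

(** * Geodesics and rainbow paths in general graphs *)

Lemma mem_edges (G : sgraph) (x y : G) : adj x y -> [set x; y] \in edges G.
Proof. by move=> xy; apply/imsetP; exists (x, y); rewrite ?inE. Qed.

Lemma path1_geodesic (G : sgraph) (x y : G) :
  adj x y -> is_geodesic x y [:: y].
Proof.
move=> xy; have neq : x != y by apply: contraTneq xy => ->; rewrite adj_irrefl.
split=> [|[|//] [_ /= eq_xy]]; first by split; rewrite /= ?xy ?inE ?neq.
by rewrite eq_xy eqxx in neq.
Qed.

Lemma path2_geodesic (G : sgraph) (x y z : G) :
    x != y -> ~~ adj x y -> adj x z -> adj z y ->
  is_geodesic x y [:: z; y].
Proof.
move=> xy not_xy xz zy.
have neq u v : @adj G u v -> u != v.
  by move=> uv; apply: contraTneq uv => ->; rewrite adj_irrefl.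
split=> [|[|v [|//]] []].
- by split; rewrite /= ?xz ?zy // !inE negb_or xy !neq.
- by move=> _ /= eq_xy; rewrite eq_xy eqxx in xy.
- by move=> /= /andP[xv _] eq_vy; rewrite -eq_vy xv in not_xy.
Qed.

Lemma strong_rainbow_connected (G : sgraph) (c : {set G} -> nat) :
  strongly_rainbow_connected c -> rainbow_connected c.
Proof. by move=> c_src x y; have [p [[p_path _] p_rb]] := c_src x y; exists p. Qed.

(** Pigeonhole: the colours along the path are distinct and below [s]. *)
Lemma rainbow_size (G : sgraph) (c : {set G} -> nat) (s : nat) (x : G) (p : seq G) :
    list_colouring (fun=> `I_s) c -> path (@adj G) x p -> rainbow c x p ->
  size p <= s.
Proof.
move=> c_lt p_path p_rb; rewrite -(size_pairmap (fun u v => c [set u; v]) x p).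
rewrite -[s](size_iota 0); apply: uniq_leq_size p_rb _ => k k_in.
rewrite mem_iota add0n /=.
elim: p x p_path k_in => //= y p IH x /andP[xy p_path].
by rewrite inE => /orP[/eqP ->|]; [apply: c_lt; apply: mem_edges | apply: IH].
Qed.

Lemma list_assignment_II (G : sgraph) (s : nat) :
  @list_assignment G s (fun=> `I_s).
Proof. by move=> e _; rewrite card_le_II. Qed.

(** * Complete multipartite graphs *)

Section Multipartite.
Variables (t : nat) (n : 'I_t -> nat) (i0 : 'I_t).
Local Notation K := (complete_multipartite n).

Definition class (i : 'I_t) : {set K} := [set x | tag x == i].

Hypothesis class_le : forall i, n i <= n i0.

Local Notation A := (class i0).

Lemma card_class i : #|class i| = n i.
Proof.
pose inc (k : 'I_(n i)) : K := Tagged (fun j => 'I_(n j)) k.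
have inc_inj : injective inc by move=> j k /eqP; rewrite eq_Tagged => /eqP.
rewrite -[RHS]card_ord -[RHS](card_imset predT inc_inj).
apply: eq_card => -[j k]; rewrite inE /=; apply/eqP/imsetP => [eq_ji|[k' _ /(congr1 tag)]//].
by rewrite /inc; case: i / eq_ji inc inc_inj => *; exists k.
Qed.

Lemma card_classC : #|~: A| + n i0 = \sum_i n i.
Proof.
rewrite addnC -card_class cardsC card_tagged sumnE big_map big_enum /=.
by apply: eq_bigr => i _; rewrite card_ord.
Qed.

(** Vertices of one class are nonadjacent, so a two-edge rainbow path between them amounts to such a
    [z]. *)
Definition separating (c : {set K} -> nat) : Prop :=
  forall x y : K, x != y -> tag x = tag y ->
    exists2 z : K, tag z != tag x & c [set x; z] != c [set y; z].

Lemma separated_geodesic (c : {set K} -> nat) (x y z : K) :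
    x != y -> tag x = tag y -> tag z != tag x -> c [set x; z] != c [set y; z] ->
  is_geodesic x y [:: z; y] /\ rainbow c x [:: z; y].
Proof.
move=> xy eq_tag zx c_neq; split.
  apply: path2_geodesic => //=; rewrite /multipartite_adj.
  - by rewrite eq_tag eqxx.
  - by rewrite eq_sym.
  - by rewrite -eq_tag.
by rewrite /rainbow /= andbT inE (setUC [set z]).
Qed.

Lemma separating_strong (c : {set K} -> nat) :
  separating c -> strongly_rainbow_connected c.
Proof.
move=> c_sep x y; have [<-|xy] := eqVneq x y; first by exists [::].
have [eq_tag|neq_tag] := eqVneq (tag x) (tag y); last first.
  by exists [:: y]; split=> //; apply: path1_geodesic.
have [z zx c_neq] := c_sep x y xy eq_tag; exists [:: z; y].
exact: separated_geodesic.
Qed.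

(** The class of [i0] is left out because its vertices index the rows; this relation is meant for
    columns. *)
Definition same_class : rel K := [rel x y | (tag x != i0) && (tag x == tag y)].

Lemma same_class_sym : symmetric same_class.
Proof.
move=> x y; rewrite /same_class /= [tag y == tag x]eq_sym.
by case: (tag x =P tag y) => [->|_]; rewrite ?andbF.
Qed.

(** No class exceeds [A], and [#|A| < r ^ #|A|]; hence the greedy choice of columns over the rows
    [A] never gets stuck. *)
Lemma same_class_small r (x : K) : 1 < r ->
  #|[set y | same_class x y] :\ x| < r ^ #|A|.
Proof.
move=> r_gt1; apply: leq_ltn_trans (ltn_expl #|A| r_gt1).
rewrite [X in _ <= X]card_class; apply: leq_trans (class_le (tag x)).
rewrite -card_class; apply/subset_leq_card/fintype.subsetP => y.
by rewrite !inE eq_sym => /and3P[_ _ /eqP ->].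
Qed.

(** * Upper bounds: colourings from the lists *)

Lemma separating_colouring r (l : {set K} -> seq nat) :
    1 < r -> (forall e, uniq (l e)) -> (forall e, r <= size (l e)) ->
    (#|~: A| <= #|A| -> #|A| <= r ^ #|~: A|) ->
  exists2 c, forall e, c e \in l e & separating c.
Proof.
move=> r_gt1 l_uniq l_size small; have r_gt0 := ltnW r_gt1.
pose L x y := l [set x; y].
suff [f [f_adm f_rows f_cols]] : exists f : K -> K -> nat,
    [/\ forall x y, f x y \in L x y,
        rows_separated [rel _ _ | true] f A (~: A)
      & rows_separated [rel x y | tag x == tag y] (fun y x => f x y) (~: A) A].
  have [|c [c_adm c_cross _]] := colouring_of_matrix A _ f_adm.
    by move=> e; apply: leq_trans (l_size e).
  exists c => // x y xy eq_tag; have [xi0|xi0] := eqVneq (tag x) i0.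
    have xA : x \in A by rewrite inE xi0.
    have yA : y \in A by rewrite inE -eq_tag xi0.
    have [//|z] := f_rows x y xA yA _ xy; rewrite inE => zA neq.
    exists z; last by rewrite !c_cross.
    by move: zA; rewrite inE xi0.
  have xA : x \notin A by rewrite inE xi0.
  have yA : y \notin A by rewrite inE -eq_tag xi0.
  have [||/=|//|z zA neq] := f_cols x y; rewrite ?in_setC ?eq_tag //.
  exists z; last by rewrite ![[set _; z]]setUC !c_cross.
  by move: zA; rewrite inE eq_sym => /eqP <-; rewrite -eq_tag eq_sym.
have L_uniq x y : uniq (L x y) by apply: l_uniq.
have L_size x y : r <= size (L x y) by apply: l_size.
have [leBA|ltAB] := leqP #|~: A| #|A|.
  (* At least as many rows as columns: the square on [S] and [~: A] tells all columns apart, and the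
     rows outside [S] are added. *)
  have [S SA cardS] := subset_of_card leBA.
  have [f [f_adm f_rows f_cols]] := square_separated r_gt1 L_uniq L_size cardS.
  (* With [e] restricted to [A], a row has at most [#|A| - 1] others to avoid, which makes the bound
     [#|A| <= r ^ #|~: A|] strict as required. *)
  have [||//||g [g_adm g_eq g_sep]] := extend_rows r_gt0 L_uniq L_size
    (e := [rel x y | (x \in A) && (y \in A)]) (S := S) (T := ~: A) (f := f).
  - by move=> x y /=; rewrite andbC.
  - move=> x; have [xA|xA] := boolP (x \in A); last first.
      rewrite (_ : _ :\ x = finset.set0) ?cards0 ?expn_gt0 ?r_gt0 //.
      by apply/setP => y; rewrite !inE /= (negPf xA) andbF.
    apply: leq_trans (small leBA); rewrite [X in _ < X](cardsD1 x) xA ltnS.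
    apply/subset_leq_card/fintype.subsetP => y /setD1P[yx].
    by rewrite in_set => /andP[_ yA]; rewrite in_setD1 yx.
  - by move=> x y xS yS _; apply: f_rows.
  exists g; split=> // [x y xA yA _|x y xA yA _ xy].
    by apply: g_sep; rewrite ?in_setT //= xA.
  have [//|z zS neq] := f_cols x y xA yA _ xy.
  by exists z; [apply: (fintype.subsetP SA) | rewrite !g_eq].
(* More columns than rows: the square is on [A] and [T], and by transposition the columns outside
   [T] are added, each avoiding only its own class. *)
have [T TB cardT] := subset_of_card (ltnW ltAB).
have [f [f_adm f_rows f_cols]] :=
  square_separated r_gt1 L_uniq L_size (esym cardT).
have [|x|||g [g_adm g_eq g_sep]] := extend_rows r_gt0
  (fun y x => L_uniq x y) (fun y x => L_size x y)
  (e := same_class)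
  (S := T) (T := A) (f := fun y x => f x y).
- exact: same_class_sym.
- exact: same_class_small.
- by move=> y x; apply: f_adm.
- by move=> x y xT yT _; apply: f_cols.
exists (fun x y => g y x); split=> // [x y xA yA _ xy|x y xA yA eq_tag xy].
  have [//|z zT neq] := f_rows x y xA yA _ xy.
  by exists z; [apply: (fintype.subsetP TB) | rewrite !g_eq].
apply: g_sep; rewrite ?in_setT //=; apply/andP; split=> //.
by move: xA; rewrite !inE.
Qed.

(** Two vertices of another class, or two in [A] with different colours towards [u] or [w], have a
    two-edge rainbow path; the remaining pairs in [A] go through the edge [uw]. *)
Lemma rainbow_colouring3 (l : {set K} -> seq nat) (u w : K) :
    tag u != i0 -> tag w != i0 -> tag u != tag w ->
    (forall e, uniq (l e)) -> (forall e, 3 <= size (l e)) ->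
  exists2 c, forall e, c e \in l e & rainbow_connected c.
Proof.
move=> ui0 wi0 uw l_uniq l_size.
pose a := head 0 (l [set u; w]).
have /choice[p pP] : forall x, exists c, (c \in l [set x; u]) && (c != a).
  (* Only the colour [a] is to be avoided, hence its repetition. *)
  move=> x; have [c c_in /andP[ca _]] :=
    list_pick_avoid2 a a (l_uniq _) (l_size [set x; u]).
  by exists c; rewrite c_in.
have /choice[q qP] : forall x, exists c,
    [&& c \in l [set x; w], c != a & c != p x].
  move=> x; have [c c_in c_neq] :=
    list_pick_avoid2 a (p x) (l_uniq _) (l_size [set x; w]).
  by exists c; rewrite c_in.
pose L y x := l [set x; y].
pose f y x := if y == u then p x else if y == w then q x else head 0 (L y x).
have wu : w == u = false by apply: contraNF uw => /eqP ->.
have l_head e : head 0 (l e) \in l e.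
  by case: (l e) (l_size e) => //= b s _; rewrite inE eqxx.
(* As [u] and [w] lie in different classes, they need no separation from each other and can be the
   prescribed start. *)
have [//|x y|x y||x|y x||g [g_adm g_eq g_sep]] := @extend_rows K K 3 L
  same_class [set u; w] A f.
- exact: l_uniq.
- exact: l_size.
- exact: same_class_sym.
- exact: same_class_small.
- rewrite /f /L; case: eqP => [->|_]; first by have /andP[] := pP x.
  by case: eqP => [->|_] //; have /and3P[] := qP x.
- move=> x y; rewrite !inE => /orP[]/eqP-> /orP[]/eqP->;
    by rewrite ?eqxx // /same_class /= 1?(eq_sym (tag w) (tag u)) (negPf uw) andbF.
have [||c [c_adm c_cross c_B]] :=
  colouring_of_matrix A (l := l) (f := fun x y => g y x).
- by move=> e; apply: leq_trans (l_size e).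
- by move=> x y; apply: g_adm.
have uA : u \notin A by rewrite inE.
have wA : w \notin A by rewrite inE.
have c_u x : x \in A -> c [set x; u] = p x.
  by move=> xA; rewrite c_cross // g_eq /f ?inE ?eqxx.
have c_w x : x \in A -> c [set x; w] = q x.
  by move=> xA; rewrite c_cross // g_eq /f ?inE ?eqxx ?wu ?orbT.
have c_uw : c [set u; w] = a by rewrite c_B.
exists c => // x y; have [<-|xy] := eqVneq x y; first by exists [::].
have [eq_tag|neq_tag] := eqVneq (tag x) (tag y); last first.
  by exists [:: y]; split=> //; have [] := path1_geodesic (neq_tag : @adj K x y).
have mid z : tag z != tag x -> c [set x; z] != c [set y; z] ->
    exists s, is_path x y s /\ rainbow c x s.
  move=> zx c_neq; exists [:: z; y].
  by have [[]] := separated_geodesic xy eq_tag zx c_neq.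
have [xi0|xi0] := eqVneq (tag x) i0; last first.
  have e_xy : same_class x y by rewrite /same_class /= xi0 eq_tag eqxx.
  have [z zA neq] := g_sep x y (in_setT x) (in_setT y) e_xy xy.
  apply: (mid z); first by move: zA; rewrite inE => /eqP ->; rewrite eq_sym.
  by rewrite ![[set _; z]]setUC !c_cross // inE -?eq_tag.
have xA : x \in A by rewrite inE xi0.
have yA : y \in A by rewrite inE -eq_tag xi0.
have [eq_p|neq_p] := eqVneq (p x) (p y); last first.
  by apply: (mid u); rewrite ?xi0 // !c_u.
have [eq_q|neq_q] := eqVneq (q x) (q y); last first.
  by apply: (mid w); rewrite ?xi0 // !c_w.
exists [:: u; w; y]; split.
  split=> //=; first by rewrite /multipartite_adj -eq_tag xi0 uw wi0 eq_sym ui0.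
  have neq (v v' : K) : tag v != tag v' -> v != v' by apply: contraNneq => ->.
  by rewrite !inE !negb_or xy !neq // -?eq_tag ?xi0 // eq_sym.
(* The three colours are [p x], [a] and [q y = q x]. *)
rewrite /rainbow /= !inE negb_or c_uw c_u // [[set w; y]]setUC c_w // -eq_q.
have /andP[_ pa] := pP x; have /and3P[_ qa qp] := qP x.
by rewrite pa eq_sym qp eq_sym qa.
Qed.

(** * Lower bounds from identical lists *)

(** The middle vertex of a two-edge rainbow path lies outside [A] and is a coordinate where the
    colour vectors of the two ends differ. *)
Lemma rainbow_short_bound (c : {set K} -> nat) s :
    list_colouring (fun=> `I_s) c -> 0 < #|~: A| ->
    (forall x y, x \in A -> y \in A -> x != y ->
      exists p, [/\ is_path x y p, rainbow c x p & size p <= 2]) ->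
  #|A| <= s ^ #|~: A|.
Proof.
move=> c_lt B_gt0 short.
have [->|[x0 x0A]] := set_0Vmem A; first by rewrite cards0.
have cross x y : x \in A -> y \notin A -> c [set x; y] < s.
  rewrite !inE => /eqP xi0 yi0; apply: c_lt; apply: mem_edges.
  by rewrite /= /multipartite_adj xi0 eq_sym.
have s_gt0 : 0 < s.
  have /card_gt0P[y] := B_gt0; rewrite inE => yA.
  exact: leq_ltn_trans (cross _ _ x0A yA).
case: s s_gt0 c_lt cross => // s _ _ cross.
pose v x : {ffun {y | y \in ~: A} -> 'I_s.+1} :=
  [ffun y => inord (c [set x; val y])].
have v_inj : {in A &, injective v}.
  move=> x y xA yA eq_v; apply/eqP; apply: contraT => xy.
  have [p [[p_path p_last _] p_rb p_size]] := short x y xA yA xy.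
  have /eqP tagx : tag x == i0 by rewrite inE in xA.
  have /eqP tagy : tag y == i0 by rewrite inE in yA.
  case: p p_path p_last p_rb p_size => [_ /= eq_xy|z [|y' [|//]]].
  - by rewrite eq_xy eqxx in xy.
  - rewrite /= /multipartite_adj => /andP[+ _] zy.
    by rewrite zy tagx tagy eqxx.
  rewrite /= /multipartite_adj => /and3P[xz _ _] -> + _.
  have zA : z \in ~: A by rewrite !inE -tagx eq_sym.
  rewrite /rainbow /= inE andbT [[set z; y]]setUC.
  have := congr1 (fun h : {ffun _ -> _} => val (h (exist _ z zA))) eq_v.
  have zA' := zA; rewrite inE in zA'.
  by rewrite /= !ffunE /= !inordK ?cross // => ->; rewrite eqxx.
rewrite -(card_in_imset v_inj); apply: leq_trans (max_card _) _.
by rewrite card_ffun card_ord card_sig.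
Qed.

End Multipartite.

Lemma list_colouring_of_lists (G : sgraph) (r : nat) (P : ({set G} -> nat) -> Prop) :
    (forall l : {set G} -> seq nat, (forall e, uniq (l e)) ->
      (forall e, r <= size (l e)) -> exists2 c, forall e, c e \in l e & P c) ->
  forall L, list_assignment r L -> exists c, list_colouring L c /\ P c.
Proof.
move=> colour L /list_assignmentP[l [l_uniq l_size lL]].
have [e|c c_in cP] := colour l l_uniq; first by rewrite l_size.
by exists c; split=> // e eG; apply: lL.
Qed.

Section LowerBounds.
Variables (G : sgraph) (s : nat).
Hypothesis colourable : forall L, @list_assignment G s L ->
  exists c, list_colouring L c /\ rainbow_connected c.

Lemma rainbow_connected_gt0 (x y : G) : x != y -> 0 < s.
Proof.
move=> xy; have [c [c_lt c_rc]] := colourable (@list_assignment_II G s).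
have [p [[p_path p_last _] p_rb]] := c_rc x y.
apply: leq_trans (rainbow_size c_lt p_path p_rb).
by case: p p_last {p_path p_rb} => //= eq_xy; rewrite eq_xy eqxx in xy.
Qed.

(** A path between distinct nonadjacent vertices has at least two edges, with distinct colours below
    [s]. *)
Lemma rainbow_connected_gt1 (x y : G) : x != y -> ~~ adj x y -> 1 < s.
Proof.
move=> xy not_xy; have [c [c_lt c_rc]] := colourable (@list_assignment_II G s).
have [p [[p_path p_last _] p_rb]] := c_rc x y.
apply: leq_trans (rainbow_size c_lt p_path p_rb).
case: p p_path p_last {p_rb} => [|z [|//]] /= => [_ eq_xy|/andP[xz _] eq_zy].
  by rewrite eq_xy eqxx in xy.
by rewrite -eq_zy xz in not_xy.
Qed.

End LowerBounds.

(** * The values of both parameters *)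

Theorem theorem3p14 (t : nat) (n : nat -> nat)
    (t_ge3 : 3 <= t)
    (n1_ge1 : 1 <= n 1)
    (n_mono : forall i, 1 <= i < t -> n i <= n i.+1) :
  let K := complete_multipartite (fun i : 'I_t => n i.+1) in
  let m := \sum_(1 <= i < t) n i in
  [/\ n t = 1 -> is_rcl K 1,
      2 <= n t -> n t < m -> is_rcl K 2
    & m <= n t -> is_rcl K (minn (ceil_root m (n t)) 3)]
  /\
  [/\ n t = 1 -> is_srcl K 1,
      2 <= n t -> n t < m -> is_srcl K 2
    & m <= n t -> is_srcl K (ceil_root m (n t))].
Proof.
move=> K m.
case: t => // t' in t_ge3 n_mono K m *.
(* Ordinals start at 0 and the class sizes at index 1, so [ord_max] is the class of size [n t]. *)
pose N (i : 'I_t'.+1) := n i.+1; pose A : {set K} := class N ord_max.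
have n_le i j : 0 < i -> i <= j -> j <= t'.+1 -> n i <= n j.
  move=> i_gt0; elim: j => [|j IH]; first by rewrite leqn0 => /eqP ->.
  rewrite leq_eqVlt => /orP[/eqP -> //|ij jt].
  apply: leq_trans (IH ij (ltnW jt)) (n_mono _ _).
  by rewrite jt (leq_trans i_gt0).
have N_le i : N i <= N ord_max by apply: n_le.
have N_gt0 i : 0 < N i by apply: leq_trans n1_ge1 (n_le _ _ _ _ _).
have cardA : #|A| = n t'.+1 by rewrite card_class.
have cardB : #|~: A| = m.
  apply/eqP; rewrite -(eqn_add2r (N ord_max)) card_classC.
  by rewrite /m big_add1 big_mkord big_ord_recr.
(* Three classes leave two besides the largest one. *)
have [u [w [ui0 wi0 uw]]] : exists u w : K,
    [/\ tag u != ord_max, tag w != ord_max & tag u != tag w].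
  have t_gt0 : 0 < t'.+1 by [].
  have t_gt1 : 1 < t'.+1 by apply: ltnW.
  pose v i : K := Tagged (fun i => 'I_(N i)) (Ordinal (N_gt0 i)).
  exists (v (Ordinal t_gt0)), (v (Ordinal t_gt1)).
  have t'_gt1 : 1 < t' by [].
  by split; rewrite -val_eqE //= neq_ltn ?t'_gt1 // ltnW.
have u_neq_w : u != w by apply: contraNneq uw => ->.
have m_gt0 : 0 < m by rewrite -cardB; apply/card_gt0P; exists u; rewrite !inE.
have srcl_rcl s : (forall L, @list_assignment K s L ->
    exists c, list_colouring L c /\ strongly_rainbow_connected c) ->
  forall L, @list_assignment K s L ->
    exists c, list_colouring L c /\ rainbow_connected c.
  move=> sP L /sP[c [c_col c_src]].
  by exists c; split=> //; apply: strong_rainbow_connected.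
(* The power bound is asked only when [m <= n t'.+1]; for larger [m] it is vacuous and [r = 2] is
   enough. *)
have upper r : 1 < r -> (m <= n t'.+1 -> n t'.+1 <= r ^ m) ->
    forall L, @list_assignment K r L ->
    exists c, list_colouring L c /\ strongly_rainbow_connected c.
  move=> r_gt1 small; apply: list_colouring_of_lists => l l_uniq l_size.
  have [|c c_in c_sep] := separating_colouring N_le r_gt1 l_uniq l_size.
    by rewrite cardA cardB.
  by exists c => //; apply: separating_strong.
have gt0 s sP : 0 < s := @rainbow_connected_gt0 K s sP u w u_neq_w.
have gt1 s : 2 <= n t'.+1 -> (forall L, @list_assignment K s L ->
    exists c, list_colouring L c /\ rainbow_connected c) -> 1 < s.
  rewrite -cardA => /card_gt1P[x [y [xA yA xy]]] sP.
  apply: (rainbow_connected_gt1 sP xy).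
  by move: xA yA; rewrite !inE /= /multipartite_adj => /eqP -> /eqP ->; rewrite eqxx.
have short_root s c : list_colouring (fun=> `I_s) c ->
    (forall x y : K, x \in A -> y \in A -> x != y ->
      exists p, [/\ is_path x y p, rainbow c x p & size p <= 2]) ->
    ceil_root m (n t'.+1) <= s.
  move=> c_lt short; rewrite ceil_root_le // -cardA -cardB.
  by apply: rainbow_short_bound c_lt _ short; rewrite cardB.
(* With at most two colours every rainbow path is short, geodesic or not. *)
have rc_root s : s <= 2 -> (forall L, @list_assignment K s L ->
    exists c, list_colouring L c /\ rainbow_connected c) ->
    ceil_root m (n t'.+1) <= s.
  move=> s_le2 /(_ _ (@list_assignment_II K s))[c [c_lt c_rc]].
  apply: (short_root s c) => // x y _ _ _; have [p [p_path p_rb]] := c_rc x y.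
  exists p; split=> //; have [p_adj _ _] := p_path.
  exact: leq_trans (rainbow_size c_lt p_adj p_rb) s_le2.
have src_root s : (forall L, @list_assignment K s L ->
    exists c, list_colouring L c /\ strongly_rainbow_connected c) ->
    ceil_root m (n t'.+1) <= s.
  move=> /(_ _ (@list_assignment_II K s))[c [c_lt c_src]].
  apply: (short_root s c) => // x y; rewrite !inE => /eqP xi0 /eqP yi0 xy.
  have [p [[p_path p_min] p_rb]] := c_src x y; exists p; split=> //.
  (* The path through [u] bounds the geodesic [p] by two edges, whatever [s] is. *)
  have [| | |q_path _] := @path2_geodesic K x y u xy; last exact: (p_min [:: u; y]).
  - by rewrite /= /multipartite_adj xi0 yi0 eqxx.
  - by rewrite /= /multipartite_adj xi0 eq_sym.
  - by rewrite /= /multipartite_adj yi0.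
have complete : n t'.+1 = 1 -> forall L, @list_assignment K 1 L ->
    exists c, list_colouring L c /\ strongly_rainbow_connected c.
  move=> n1; apply: list_colouring_of_lists => l _ l_size.
  exists (fun e => head 0 (l e)).
    by move=> e; case: (l e) (l_size e) => //= a q _; rewrite inE eqxx.
  (* All classes are singletons, so there is no pair to separate. *)
  apply: separating_strong => x y xy eq_tag.
  suff : #|class N (tag x)| <= 1.
    move/card_le1_eqP/(_ x y); rewrite !inE eq_tag eqxx => /(_ isT isT) eq_xy.
    by rewrite eq_xy eqxx in xy.
  by rewrite card_class -n1.
have m_ge2 : m <= n t'.+1 -> 1 < n t'.+1.
  move=> le_mn; apply: leq_trans le_mn; rewrite -cardB.
  by apply/card_gt1P; exists u, w; rewrite !inE.
have root_gt1 : m <= n t'.+1 -> 1 < ceil_root m (n t'.+1).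
  by move=> /m_ge2 n_ge2; rewrite ltnNge ceil_root_le // exp1n -ltnNge.
have root_ok : n t'.+1 <= ceil_root m (n t'.+1) ^ m by rewrite -ceil_root_le.
split; split.
- by move=> n1; split=> [|s /gt0 //]; apply: srcl_rcl; apply: complete.
- move=> n_ge2 lt_nm; split=> [|s /(gt1 _ n_ge2) //].
  by apply: srcl_rcl; apply: upper => //; rewrite leqNgt lt_nm.
- move=> le_mn; split=> [|s sP]; last first.
    (* Either [s] is at least 3, or [s <= 2] and the root bound applies. *)
    by rewrite geq_min; case: (leqP 3 s) => [_|/rc_root->]; rewrite ?orbT.
  (* Up to 3 the strong colouring attains the minimum; beyond, three colours suffice by paths of
     length three. *)
  case: (leqP (ceil_root m (n t'.+1)) 3) => [_|gt3].
    by apply: srcl_rcl; apply: upper => //; apply: root_gt1.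
  apply: list_colouring_of_lists => l.
  exact: (rainbow_colouring3 N_le ui0 wi0 uw).
- by move=> n1; split=> [|s /srcl_rcl/gt0 //]; apply: complete.
- move=> n_ge2 lt_nm; split=> [|s /srcl_rcl/(gt1 _ n_ge2) //].
  by apply: upper => //; rewrite leqNgt lt_nm.
- by move=> le_mn; split=> [|s /src_root //]; apply: upper => //; apply: root_gt1.
Qed.
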